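(* Let $n\geqslant 1$ and $t\geqslant 1$ be integers, let $q\in[n]$, let $A_0\subseteq[n]\setminus\{q\}$, and let $A_1,\ldots,A_t$ be distinct subsets of $A_0$ such that $|A_0\setminus A_i|=1$ for $1\leqslant i\leqslant t$. Let $c_0,\ldots,c_t\geqslant 0$ be real numbers, and set $C=\sum_{i=0}^t c_i|A_i|$. Then, in $\mathbb C[\mathfrak S_n]$, \[ C\sum_{j=0}^t c_j\bigl(\alpha_{A_j\cup\{q\}}-\alpha_{A_j}\bigr)\succeq \sum_{i=0}^t c_i^2\alpha_{A_i}+\sum_{0\leqslant i<j\leqslant t}c_ic_j\bigl(\alpha_{A_0}+\alpha_{A_i\cap A_j}\bigr). \]
   Context: Let $[n]=\{1,\ldots,n\}$ and let $1$ be the identity of $\mathbb C[\mathfrak S_n]$. For $A\subseteq[n]$ regard $\mathfrak S_A$ as the subgroup of $\mathfrak S_n$ fixing the complement of $A$. For nonempty $A\subseteq[n]$ define \[ \alpha_A=\frac{1}{(|A|-1)!}\sum_{\sigma\in\mathfrak S_A}(1-\sigma)\in\mathbb C[\mathfrak S_n],\] and put $\alpha_\varnothing=0$. Let $*$ be the antilinear involution on $\mathbb C[\mathfrak S_n]$ with $\sigma^*=\sigma^{-1}$. For self-adjoint $A,B\in\mathbb C[\mathfrak S_n]$, write $A\succeq 0$ if $\rho(A)$ is positive semidefinite in every (finite-dimensional) unitary representation $\rho$ of $\mathfrak S_n$, and $A\succeq B$ if $A-B\succeq 0$. *)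

(* Defs.v *)
From HB Require Import structures.
From mathcomp Require Import all_boot all_order all_algebra all_fingroup.
From mathcomp Require Import spectral mxrepresentation complex reals.

Set Implicit Arguments.
Unset Strict Implicit.
Unset Printing Implicit Defensive.

Import Order.TTheory GRing.Theory Num.Theory.
Local Open Scope ring_scope.
Local Open Scope sesquilinear_scope.

(* The group algebra C[G], as the space of coefficient functions
   a = \sum_g (a g) g, with its pointwise R[i]-module structure. *)
Notation group_algebra R gT := {ffun gT -> R[i]}.

Definition ga_basis (R : realType) (gT : finGroupType) (g : gT) :
    group_algebra R gT :=
  [ffun x => (x == g)%:R].

(* The coefficient of h in (\sum_g (a g) g)^* is the conjugate of a h^-1. *)
Definition ga_star (R : realType) (gT : finGroupType)
    (a : group_algebra R gT) : group_algebra R gT :=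
  [ffun g => (a (g^-1)%g)^*].

Definition unitary_repr (R : realType) (gT : finGroupType) (d : nat)
    (rho : mx_representation R[i] [set: gT] d) : Prop :=
  forall g : gT, rho g \is unitarymx.

(* Linear extension of a representation to the group algebra. *)
Definition ga_op (R : realType) (gT : finGroupType) (d : nat)
    (rho : mx_representation R[i] [set: gT] d)
    (a : group_algebra R gT) : 'M[R[i]]_d :=
  \sum_(g : gT) a g *: rho g.

(* Matrices of mx_representation act on row vectors from the right, whence
   the form u M u^*.  In R[i], 0 <= z includes that z is real. *)
Definition psdmx (R : realType) (d : nat) (M : 'M[R[i]]_d) : Prop :=
  M ^t* = M /\ forall u : 'rV[R[i]]_d, 0 <= (u *m M *m u ^t*) 0 0.

Definition ga_psd (R : realType) (gT : finGroupType)
    (a : group_algebra R gT) : Prop :=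
  forall (d : nat) (rho : mx_representation R[i] [set: gT] d),
    unitary_repr rho -> psdmx (ga_op rho a).

(* The order is only defined between self-adjoint elements, so
   self-adjointness of both sides is part of the assertion. *)
Definition ga_succeq (R : realType) (gT : finGroupType)
    (a b : group_algebra R gT) : Prop :=
  [/\ ga_star a = a, ga_star b = b & ga_psd (a - b)].

(* [Sym A] consists of the permutations fixing every point outside A. *)
Definition alpha (R : realType) (n : nat) (A : {set 'I_n}) :
    group_algebra R {perm 'I_n} :=
  if A == set0 then 0
  else (((#|A|.-1)`!)%:R)^-1 *:
         \sum_(s in Sym A) (ga_basis R 1%g - ga_basis R s).

(* Main.v *)
(* Write [P A] for the projection onto the [Sym A]-invariants, so that
   [alpha A] acts as [#|A| (1 - P A)], and let [B = q |: A 0].  Put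
   [E x y = (x y) (P (B :\ y) - P B)]: these are the operators [v_x v_y^*] on
   the standard isotypic component of [Sym B], whose projection [Z] is a
   multiple of the sum of the [E x x].  With [W = 1 - P B - Z],
     [alpha A = #|A| W - #|A| P A W + k lap A],
   where [lap A] is the sum of [(v_x - v_y) (v_x - v_y)^*] over pairs in [A].
   In the difference of the two sides of the inequality
   - the terms in [W] cancel, as [#|X :|: Y| + #|X :&: Y| = #|X| + #|Y|];
   - the terms [#|A| P A W] are positive semidefinite, and those entering with
     the wrong sign have [A = q |: A j], which is [B] or [B :\ x], where they
     vanish;
   - the terms in [lap] add up to [k S S^*] with
     [S = \sum_i c_i (#|A i| v_q - \sum_(x in A i) v_x)], because any two [A i],
     [A j] differ by at most one point on each side. *)
Require Import Defs.
From mathcomp Require Import all_boot all_order all_algebra all_fingroup.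
From mathcomp Require Import complex reals.
From mathcomp Require Import spectral mxrepresentation ring.

Set Implicit Arguments.
Unset Strict Implicit.
Unset Printing Implicit Defensive.

Import Order.TTheory GRing.Theory Num.Theory.
Local Open Scope ring_scope.
Local Open Scope sesquilinear_scope.

(** * Quadratic identities for kernels summed over finite sets *)

Section PairIdentities.

Variables (K : comNzRingType) (T : finType) (g : T -> T -> K).
Implicit Types (A X Y : {set T}) (q x y : T).

(* For [g x y = v_x v_y^*] this is the sum of |v_x - v_y|^2 over the pairs
   {x, y} in [A]. *)
Definition laplacian A : K :=
  #|A|%:R * (\sum_(x in A) g x x) - \sum_(x in A) \sum_(y in A) g x y.

(* For [g x y = v_x v_y^*] this is [s X (s Y)^*] where
   [s X = #|X| v_q - \sum_(x in X) v_x]. *)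
Definition star_form q X Y : K :=
  #|X|%:R * #|Y|%:R * g q q - #|X|%:R * (\sum_(y in Y) g q y)
  - #|Y|%:R * (\sum_(x in X) g x q) + \sum_(x in X) \sum_(y in Y) g x y.

Lemma sum2_setU1l a X Y : a \notin X ->
  \sum_(x in a |: X) \sum_(y in Y) g x y
  = (\sum_(y in Y) g a y) + \sum_(x in X) \sum_(y in Y) g x y.
Proof. exact: big_setU1. Qed.

Lemma sum2_setU1r b X Y : b \notin Y ->
  \sum_(x in X) \sum_(y in b |: Y) g x y
  = (\sum_(x in X) g x b) + \sum_(x in X) \sum_(y in Y) g x y.
Proof.
move=> bY; rewrite -big_split; apply: eq_bigr => x _.
by rewrite big_setU1.
Qed.

Lemma laplacianU1 q X : q \notin X ->
  laplacian (q |: X) = laplacian X + (\sum_(x in X) g x x) + #|X|%:R * g q q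
    - (\sum_(x in X) g q x) - \sum_(x in X) g x q.
Proof.
move=> qX; rewrite /laplacian sum2_setU1l // sum2_setU1r // !big_setU1 //=.
by rewrite cardsU1 qX /= natrD; ring.
Qed.

(** With [I] the intersection, [X] is [I] or [a |: I] and [Y] is [I] or [b |: I]; in each of the
    four cases both sides expand to the same polynomial in values of [g] and its sums over [I]. As
    [g] need not be symmetric, both orders of [X] and [Y] occur on the right. *)
Lemma laplacian_pair q X Y : q \notin X -> q \notin Y ->
    (#|X :\: Y| <= 1)%N -> (#|Y :\: X| <= 1)%N ->
  #|X|%:R * (laplacian (q |: Y) - laplacian Y)
  + #|Y|%:R * (laplacian (q |: X) - laplacian X)
  - (laplacian (X :|: Y) + laplacian (X :&: Y))
  = star_form q X Y + star_form q Y X.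
Proof.
move=> qX qY; rewrite !laplacianU1 //.
have le1 (m : nat) : (m <= 1)%N -> m == 1%N \/ m == 0%N.
  by case: m => [|[|]]; auto.
move=> /le1 XY /le1 YX.
pose I := X :&: Y.
have XI : X = (X :\: Y) :|: I by rewrite setUC setID.
have YI : Y = (Y :\: X) :|: I by rewrite /I setIC setUC setID.
have sub (Z : {set T}) a : a \notin Z ->
  ((a |: Z) :|: Z = a |: Z) * ((a |: Z) :&: Z = Z).
  by move=> aZ; split; [rewrite (setUidPl _) | rewrite (setIidPr _)];
     rewrite ?subsetUr.
case: XY => [/cards1P[a Da]|]; last rewrite cards_eq0 => /eqP Da.
  have aI : a \notin I.
    by have := set11 a; rewrite -Da !inE => /andP[/negPf->]; rewrite andbF.
  rewrite Da in XI.
  case: YX => [/cards1P[b Db]|]; last rewrite cards_eq0 => /eqP Db.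
    have bI : b \notin I.
      by have := set11 b; rewrite -Db !inE => /andP[/negPf->].
    rewrite Db in YI.
    have ab : a \notin b |: I.
      by have := set11 a; rewrite -Da -YI inE => /andP[].
    have -> : X :|: Y = a |: (b |: I) by rewrite XI YI setUACA setUid setUA.
    have -> : X :&: Y = I by [].
    rewrite XI YI /laplacian /star_form.
    rewrite !(sum2_setU1l _ ab, sum2_setU1r _ ab).
    rewrite !(sum2_setU1l _ aI, sum2_setU1r _ aI).
    rewrite !(sum2_setU1l _ bI, sum2_setU1r _ bI).
    rewrite !(big_setU1 _ ab, big_setU1 _ aI, big_setU1 _ bI) /=.
    by rewrite !cardsU1 ab aI bI /= !natrD; ring.
  rewrite Db set0U in YI.
  have [-> ->] : X :|: Y = a |: I /\ X :&: Y = I.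
    by split=> //; rewrite XI YI (sub _ _ aI).
  rewrite XI YI /laplacian /star_form.
  rewrite !(sum2_setU1l _ aI, sum2_setU1r _ aI).
  rewrite !(big_setU1 _ aI) /= !cardsU1 aI /= !natrD.
  by ring.
rewrite Da set0U in XI.
case: YX => [/cards1P[b Db]|]; last rewrite cards_eq0 => /eqP Db.
  have bI : b \notin I.
    by have := set11 b; rewrite -Db !inE => /andP[/negPf->].
  rewrite Db in YI.
  have [-> ->] : X :|: Y = b |: I /\ X :&: Y = I.
    by split=> //; rewrite XI YI setUC sub.
  rewrite XI YI /laplacian /star_form.
  rewrite !(sum2_setU1l _ bI, sum2_setU1r _ bI).
  rewrite !(big_setU1 _ bI) /= !cardsU1 bI /= !natrD.
  by ring.
rewrite Db set0U in YI.
by rewrite XI YI setUid setIid /laplacian /star_form; ring.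
Qed.

Lemma sum2_ltn (m : nat) (h : 'I_m -> 'I_m -> K) :
  \sum_i \sum_j h i j
  = \sum_i h i i + \sum_(i < m) \sum_(j < m | (i < j)%N) (h i j + h j i).
Proof.
under [X in _ = _ + X]eq_bigr do rewrite big_split.
rewrite big_split /= [X in _ = _ + (_ + X)](exchange_big_dep xpredT) //=.
rewrite -!big_split /=; apply: eq_bigr => i _.
rewrite (bigD1 i) //= (bigID (fun j : 'I_m => (i < j)%N)) /=.
congr (_ + (_ + _)); apply: eq_bigl => j.
  by rewrite -val_eqE /=; case: ltngtP.
by rewrite -val_eqE /=; case: ltngtP.
Qed.

End PairIdentities.

(** * Symmetrizing projections in a unitary representation *)

Section Symmetrizers.

Variables (C : numClosedFieldType) (T : finType) (d : nat).
Variable rho : mx_representation C [set: {perm T}] d.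
Hypothesis rhoU : forall s, rho s \is unitarymx.

Implicit Types (s t : {perm T}) (A B : {set T}) (x y z : T).

Lemma rhoM s t : rho (s * t)%g = rho s *m rho t.
Proof. by rewrite repr_mxM ?inE. Qed.

Lemma rho1 : rho 1%g = 1%:M.
Proof. exact: repr_mx1. Qed.

Lemma rho_adj s : (rho s)^t* = rho s^-1%g.
Proof.
have /unitarymxP h := rhoU s.
by rewrite -[LHS]mul1mx -rho1 -(mulVg s) rhoM -mulmxA h mulmx1.
Qed.

Lemma adjmxD m p (M N : 'M[C]_(m, p)) : (M + N)^t* = M^t* + N^t*.
Proof. by rewrite linearD map_mxD. Qed.

Lemma adjmxB m p (M N : 'M[C]_(m, p)) : (M - N)^t* = M^t* - N^t*.
Proof. by rewrite linearB map_mxB. Qed.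

Lemma adjmxZ m p a (M : 'M[C]_(m, p)) : (a *: M)^t* = a^* *: M^t*.
Proof. by rewrite linearZ map_mxZ. Qed.

Lemma adjmxM m p r (M : 'M[C]_(m, p)) (N : 'M[C]_(p, r)) :
  (M *m N)^t* = N^t* *m M^t*.
Proof. by rewrite trmx_mul map_mxM. Qed.

Lemma adjmx_sum m p (I : finType) (Q : pred I) (F : I -> 'M[C]_(m, p)) :
  (\sum_(i | Q i) F i)^t* = \sum_(i | Q i) (F i)^t*.
Proof. by rewrite linear_sum map_mx_sum. Qed.

Lemma mul_adjmx_ge0 m (v : 'rV[C]_m) : 0 <= (v *m v^t*) 0 0.
Proof. by rewrite -dotmxE; apply: dnorm_ge0. Qed.

Lemma form_mul_adj_ge0 m p (u : 'rV[C]_m) (M : 'M[C]_(m, p)) :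
  0 <= (u *m (M *m M^t*) *m u^t*) 0 0.
Proof. by rewrite mulmxA -mulmxA -adjmxM mul_adjmx_ge0. Qed.

Definition sym_proj A : 'M[C]_d :=
  (#|A|`!)%:R^-1 *: \sum_(s in Sym A) rho s.

Local Notation P := sym_proj.

Lemma fact_natr_neq0 m : (m`!)%:R != 0 :> C.
Proof. by rewrite pnatr_eq0 -lt0n fact_gt0. Qed.

Lemma rho_sym_proj A s : s \in Sym A -> rho s *m P A = P A.
Proof.
move=> sA; rewrite -scalemxAr; congr (_ *: _); rewrite mulmx_sumr.
rewrite [RHS](reindex_inj (mulgI s)) /=.
by apply: eq_big => [t|t _]; rewrite ?rhoM // groupMl.
Qed.

Lemma sym_proj_adj A : (P A)^t* = P A.
Proof.
rewrite adjmxZ fmorphV rmorph_nat; congr (_ *: _); rewrite adjmx_sum.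
rewrite [RHS](reindex_inj invg_inj) /=.
by apply: eq_big => [s|s _]; rewrite ?groupV ?rho_adj.
Qed.

Lemma sym_proj_fix A (m : nat) (M : 'M[C]_(d, m)) :
  (forall s, s \in Sym A -> rho s *m M = M) -> P A *m M = M.
Proof.
move=> h; rewrite -scalemxAl mulmx_suml (eq_bigr (fun=> M)) //.
rewrite sumr_const card_Sym -[M *+ _]scaler_nat scalerA mulVf ?scale1r //.
exact: fact_natr_neq0.
Qed.

Lemma SymS A B s : A \subset B -> s \in Sym A -> s \in Sym B.
Proof. by move=> AB; rewrite !inE => /subset_trans; apply. Qed.

Lemma sym_projSr A B : A \subset B -> P A *m P B = P B.
Proof.
by move=> AB; apply: sym_proj_fix => s sA; rewrite rho_sym_proj ?(SymS AB).
Qed.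

Lemma sym_projSl A B : A \subset B -> P B *m P A = P B.
Proof.
move=> AB; have /(congr1 (fun M => M^t*)) := sym_projSr AB.
by rewrite adjmxM !sym_proj_adj.
Qed.

(** Conjugation by [s] maps [Sym A] onto [Sym (s @: A)], since a product of permutations applies its
    left factor first. *)
Lemma sym_proj_rho A s : P A *m rho s = rho s *m P (s @: A).
Proof.
rewrite -scalemxAl -scalemxAr card_imset; last exact: perm_inj.
congr (_ *: _); rewrite mulmx_suml mulmx_sumr.
rewrite [RHS](reindex_inj (@conjg_inj _ s)) /=.
apply: eq_big => [t|t _]; last by rewrite -!rhoM conjgC.
rewrite !inE; apply/subsetP/subsetP => h x; rewrite inE => hx.
  have : (t (s^-1%g x) != s^-1%g x).
    by apply: contra hx => /eqP hx; rewrite conjgE !permM hx permKV.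
  by move=> /h hA; apply/imsetP; exists (s^-1%g x); rewrite ?permKV.
have : (t ^ s)%g (s x) != s x.
  by rewrite conjgE !permM permK; apply: contra hx => /eqP/perm_inj->.
by move=> /h /imsetP[y yA /perm_inj->].
Qed.

(** * Matrix units on the standard isotypic component *)

Section MatrixUnits.

Variable B : {set T}.

(* In the copy of the standard representation of [Sym B], [mx_unit x y] is the
   operator v_x v_y^* where v_x is the unit vector fixed by [Sym (B :\ x)]. *)
Definition mx_unit x y : 'M[C]_d := rho (tperm x y) *m P (B :\ y) - P B.

Local Notation E := mx_unit.

Lemma tperm_Sym A x y : x \in A -> y \in A -> tperm x y \in Sym A.
Proof.
move=> xA yA; rewrite inE; apply/subsetP => z; rewrite inE.
by case: tpermP => [->|->|]; rewrite ?eqxx.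
Qed.

Lemma rho_mx_unit s x y : x \in B -> y \in B -> s \in Sym B ->
  rho s *m E x y = E (s^-1%g x) y.
Proof.
move=> xB yB sB; rewrite mulmxBr (rho_sym_proj sB) mulmxA -rhoM.
congr (_ - _); set x' := s^-1%g x.
have x'B : x' \in B.
  by rewrite /x' perm_closed //; move: sB; rewrite -groupV inE.
pose h := (tperm x' y * s * tperm x y)%g.
have hy : h \in Sym (B :\ y).
  rewrite inE; apply/subsetP => z; rewrite inE => hz.
  rewrite in_setD1; apply/andP; split.
    by apply: contra hz => /eqP->; rewrite !permM tpermR permKV tpermL.
  have : h \in Sym B by rewrite !groupM // tperm_Sym.
  by rewrite inE => /subsetP; apply; rewrite inE.
have -> : (s * tperm x y = tperm x' y * h)%g by rewrite !mulgA tperm2 mul1g.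
by rewrite rhoM -mulmxA (rho_sym_proj hy).
Qed.

Lemma imset_tpermD1 x y : x \in B -> y \in B ->
  tperm x y @: (B :\ y) = B :\ x.
Proof.
move=> xB yB; rewrite (can2_imset_pre _ (tpermK x y) (tpermK x y)).
apply/setP => z; rewrite !inE (can2_eq (tpermK x y) (tpermK x y)) tpermR.
by rewrite perm_closed //; have := tperm_Sym xB yB; rewrite inE.
Qed.

Lemma mx_unit_adj x y : x \in B -> y \in B -> (E x y)^t* = E y x.
Proof.
move=> xB yB; rewrite adjmxB adjmxM !sym_proj_adj rho_adj tpermV.
by rewrite sym_proj_rho imset_tpermD1 // tpermC.
Qed.

Lemma mx_unit_diag x : E x x = P (B :\ x) - P B.
Proof. by rewrite /E tperm1 rho1 mul1mx. Qed.

Lemma sym_proj_mx_unit0 x y : x \in B -> y \in B -> P B *m E x y = 0.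
Proof.
move=> xB yB; rewrite mulmxBr mulmxA.
have -> : P B *m rho (tperm x y) = P B.
  rewrite sym_proj_rho im_perm_on ?rho_sym_proj ?tperm_Sym //.
  by have := tperm_Sym xB yB; rewrite inE.
by rewrite sym_projSl ?subD1set // sym_projSr // subrr.
Qed.

Lemma sym_proj_mx_unit_out A x y :
    A \subset B -> x \in B -> y \in B -> x \notin A ->
  P A *m E x y = E x y.
Proof.
move=> AB xB yB xA; apply: sym_proj_fix => s sA.
rewrite rho_mx_unit ?(SymS AB) // (out_perm _ xA) //.
by move: sA; rewrite -groupV inE.
Qed.

(* Left multiplication by [P A] cannot distinguish the points of [A]. *)
Lemma sym_proj_mx_unit_in A x y :
    A \subset B -> x \in A -> y \in B ->
  #|A|%:R *: (P A *m E x y) = \sum_(z in A) E z y.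
Proof.
move=> AB xA yB; have AinB := subsetP AB.
have h z : z \in A -> P A *m E z y = P A *m E x y.
  move=> zA; have tA := tperm_Sym xA zA.
  have -> : E z y = rho (tperm x z) *m E x y.
    by rewrite rho_mx_unit ?(AinB _ xA) ?(SymS AB) // tpermV tpermL.
  rewrite mulmxA sym_proj_rho im_perm_on ?rho_sym_proj //.
  by move: tA; rewrite inE.
transitivity (P A *m \sum_(z in A) E z y).
  by rewrite mulmx_sumr (eq_bigr _ h) sumr_const scaler_nat.
apply: sym_proj_fix => s sA; rewrite mulmx_sumr.
rewrite [RHS](reindex_inj (@perm_inj _ s^-1%g)) /=.
move: (sA); rewrite -groupV inE => sVA.
apply: eq_big => z; first by rewrite perm_closed.
by move=> zA; rewrite rho_mx_unit ?(AinB _ zA) ?(SymS AB).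
Qed.

(** The sum is a multiple of [P B *m E y y], and the standard component has no
    [Sym B]-invariants. *)
Lemma sum_mx_unit y : y \in B -> \sum_(x in B) E x y = 0.
Proof.
move=> yB; rewrite -(sym_proj_mx_unit_in (subxx B) yB yB).
by rewrite sym_proj_mx_unit0 // scaler0.
Qed.

(** This encodes that v_y has norm 1: [P B] kills [E y z] and [P (B :\ y)] fixes it, which leaves
    [rho (tperm x y) *m E y z]. *)
Lemma mx_unitM x y z : x \in B -> y \in B -> z \in B ->
  E x y *m E y z = E x z.
Proof.
move=> xB yB zB; rewrite mulmxBl sym_proj_mx_unit0 // subr0 -mulmxA.
rewrite sym_proj_mx_unit_out ?subD1set ?setD11 //.
by rewrite rho_mx_unit ?tperm_Sym // tpermV tpermR.
Qed.

(** The |B| unit vectors v_x form a tight frame of a space of dimension |B| - 1, so comparing traces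
    gives the factor that turns the sum of the [E x x] into a projection. For |B| = 1 it is 0, as
    are all [E x x]. *)
Definition std_scale : C := #|B|.-1%:R / #|B|%:R.
Local Notation k := std_scale.

Definition std_proj : 'M[C]_d := k *: \sum_(x in B) E x x.
Local Notation Z := std_proj.

(** The inner product of v_x and v_z is -1 / (|B| - 1): on [E z w], [E x x] acts as [P (B :\ x)],
    which averages over the points other than [x], and the v_y sum to 0. *)
Lemma mx_unit_diagM x z w : x \in B -> z \in B -> w \in B -> x != z ->
  #|B|.-1%:R *: (E x x *m E z w) = - E x w.
Proof.
move=> xB zB wB xz; rewrite mx_unit_diag mulmxBl sym_proj_mx_unit0 // subr0.
have -> : #|B|.-1 = #|B :\ x| by rewrite (cardsD1 x) xB.
rewrite sym_proj_mx_unit_in ?subD1set //; last by rewrite !inE eq_sym xz.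
apply/eqP; rewrite -addr_eq0 addrC; apply/eqP.
by have := sum_mx_unit wB; rewrite (big_setD1 _ xB).
Qed.

(** After multiplication by |B| - 1, the summand x = z contributes |B| - 1 copies of [E z w] and the
    other summands together one more. *)
Lemma std_proj_mx_unit z w : z \in B -> w \in B -> Z *m E z w = E z w.
Proof.
move=> zB wB.
have B0 : (0 < #|B|)%N by apply/card_gt0P; exists z.
have N0 : #|B|%:R != 0 :> C by rewrite pnatr_eq0 -lt0n.
apply: (scalerI N0); rewrite -scalemxAl scalerA /k mulrCA divff // mulr1.
rewrite mulmx_suml (big_setD1 _ zB) /= scalerDr mx_unitM // scaler_sumr.
rewrite (eq_bigr (fun x => - E x w)); last first.
  by move=> x; rewrite !inE => /andP[xz xB]; rewrite mx_unit_diagM.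
rewrite sumrN; have := sum_mx_unit wB; rewrite (big_setD1 _ zB) /=.
move=> /eqP; rewrite addrC addr_eq0 => /eqP->; rewrite opprK.
by rewrite -[in X in _ + X](scale1r (E z w)) -scalerDl natr1 prednK.
Qed.

Lemma std_scale_ge0 : 0 <= k.
Proof. by rewrite divr_ge0 ?ler0n. Qed.

Lemma std_proj_adj : Z^t* = Z.
Proof.
rewrite adjmxZ adjmx_sum; congr (_ *: _).
  by rewrite geC0_conj ?std_scale_ge0.
by apply: eq_bigr => x xB; rewrite mx_unit_adj.
Qed.

Lemma std_proj_idem : Z *m Z = Z.
Proof.
rewrite {2 3}/Z -scalemxAr mulmx_sumr; congr (_ *: _).
by apply: eq_bigr => x xB; rewrite std_proj_mx_unit.
Qed.

Lemma sym_proj_std_proj0 : P B *m Z = 0.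
Proof.
rewrite -scalemxAr mulmx_sumr big1 ?scaler0 // => x xB.
by rewrite sym_proj_mx_unit0.
Qed.

Lemma sym_proj_std_proj A : A \subset B ->
  #|A|%:R *: (P A *m Z)
  = k *: (#|A|%:R *: (\sum_(x in B :\: A) E x x)
          + \sum_(x in A) \sum_(y in A) E x y).
Proof.
move=> AB; rewrite -scalemxAr scalerA mulrC -scalerA; congr (_ *: _).
rewrite mulmx_sumr (big_setID A) /= (setIidPr AB) addrC scalerDr.
congr (_ *: _ + _).
  apply: eq_bigr => x; rewrite inE => /andP[xA xB].
  by rewrite sym_proj_mx_unit_out.
rewrite scaler_sumr exchange_big /=; apply: eq_bigr => x xA.
by rewrite sym_proj_mx_unit_in // (subsetP AB).
Qed.

(** The explicit formula for [#|A|%:R *: (P A *m Z)] is self-adjoint, so [P A *m Z] equals its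
    adjoint [Z *m P A]. For empty [A] the factor |A| cannot be cancelled, but then [P A] is the
    identity. *)
Lemma sym_proj_std_projC A : A \subset B -> P A *m Z = Z *m P A.
Proof.
move=> AB; have [A0|] := eqVneq #|A| 0.
  have -> : P A = 1%:M.
    rewrite -[P A]mulmx1; apply: sym_proj_fix => s; rewrite inE => sA.
    by rewrite mulmx1 (perm_on_id sA) ?A0 // rho1.
  by rewrite mul1mx mulmx1.
rewrite -[_ == _](pnatr_eq0 C) => A0; apply: (scalerI A0).
have -> : Z *m P A = (P A *m Z)^t*.
  by rewrite adjmxM std_proj_adj sym_proj_adj.
rewrite -[in RHS](rmorph_nat (@Num.conj C)) -adjmxZ sym_proj_std_proj //.
rewrite adjmxZ geC0_conj ?std_scale_ge0 //; congr (_ *: _).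
rewrite adjmxD adjmxZ rmorph_nat !adjmx_sum; congr (_ *: _ + _).
  by apply: eq_bigr => x; rewrite inE => /andP[xA xB]; rewrite mx_unit_adj.
rewrite exchange_big; apply: eq_bigr => x xA; rewrite adjmx_sum.
by apply: eq_bigr => y yA; rewrite mx_unit_adj ?(subsetP AB).
Qed.

(** * The complement of the trivial and standard components *)

Definition rest_proj : 'M[C]_d := 1%:M - P B - Z.
Local Notation W := rest_proj.

Lemma rest_proj_adj : W^t* = W.
Proof.
by rewrite /W !adjmxB sym_proj_adj std_proj_adj trmx1 map_mx1.
Qed.

Lemma rest_proj_idem : W *m W = W.
Proof.
have ZP0 : Z *m P B = 0 by rewrite -sym_proj_std_projC ?sym_proj_std_proj0.
rewrite {1}/W !mulmxBl mul1mx.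
rewrite {2 3}/W !mulmxBr !mulmx1 sym_projSl // sym_proj_std_proj0 ZP0.
by rewrite std_proj_idem !subrr !subr0 subrr subr0.
Qed.

Lemma sym_proj_rest_projC A : A \subset B -> P A *m W = W *m P A.
Proof.
move=> AB; rewrite /W !mulmxBr !mulmxBl mulmx1 mul1mx.
by rewrite (sym_projSl AB) (sym_projSr AB) sym_proj_std_projC.
Qed.

Definition rest_part A : 'M[C]_d := #|A|%:R *: (P A *m W).

Lemma rest_part_full : rest_part B = 0.
Proof.
rewrite /rest_part /W !mulmxBr mulmx1 sym_projSl // sym_proj_std_proj0.
by rewrite subrr subr0 scaler0.
Qed.

(** A vector fixed by [Sym (B :\ x)] has only trivial and standard components under [Sym B]:
    [P (B :\ x)] is [E x x + P B], and [Z] fixes the first term and kills the second. *)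
Lemma rest_partD1 x : x \in B -> rest_part (B :\ x) = 0.
Proof.
move=> xB; rewrite /rest_part /W !mulmxBr mulmx1.
rewrite sym_projSr ?subD1set // -mx_unit_diag.
rewrite sym_proj_std_projC ?subD1set //.
have -> : P (B :\ x) = E x x + P B by rewrite mx_unit_diag subrK.
rewrite mulmxDr std_proj_mx_unit // -sym_proj_std_projC // sym_proj_std_proj0.
by rewrite addr0 subrr scaler0.
Qed.

(** Commuting orthogonal projections have a projection as product, so [P A *m W] is its own product
    with its adjoint. *)
Lemma rest_part_psd A (u : 'rV[C]_d) : A \subset B ->
  0 <= (u *m rest_part A *m u^t*) 0 0.
Proof.
move=> AB; rewrite -scalemxAr -scalemxAl mxE mulr_ge0 ?ler0n //.
have -> : P A *m W = (P A *m W) *m (P A *m W)^t*.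
  rewrite adjmxM rest_proj_adj sym_proj_adj mulmxA -(mulmxA _ W W).
  by rewrite rest_proj_idem sym_proj_rest_projC // -mulmxA sym_projSl.
exact: form_mul_adj_ge0.
Qed.

(** Since [P A *m P B = P B], splitting the identity as [P B + Z + W] gives
    [1 - P A = (W - P A W) + (Z - P A Z)]. In the second bracket the points of [B :\: A] cancel. *)
Lemma laplacian_decomp A : A \subset B ->
  #|A|%:R *: (1%:M - P A)
  = #|A|%:R *: W - rest_part A
    + k *: (#|A|%:R *: (\sum_(x in A) E x x)
            - \sum_(x in A) \sum_(y in A) E x y).
Proof.
move=> AB; have h := sym_proj_std_proj AB.
have hZ : #|A|%:R *: Z = k *: (#|A|%:R *: (\sum_(x in A) E x x)
     + #|A|%:R *: (\sum_(x in B :\: A) E x x)).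
  rewrite -scalerDr scalerA mulrC -scalerA; congr (_ *: _).
  by rewrite {1}/Z [in LHS](big_setID A) /= (setIidPr AB).
have -> : k *: (#|A|%:R *: (\sum_(x in A) E x x)
            - \sum_(x in A) \sum_(y in A) E x y)
  = #|A|%:R *: Z - #|A|%:R *: (P A *m Z).
  by rewrite h hZ -scalerBr opprD addrA addrK.
have -> : rest_part A = #|A|%:R *: (P A - P B - P A *m Z).
  by rewrite /rest_part /W !mulmxBr mulmx1 sym_projSr.
rewrite -!scalerBr -scalerDr /W; congr (_ *: _).
rewrite !opprB !addrA addrAC.
rewrite (addrAC _ (P A *m Z) (P B)) (addrAC _ (P A *m Z) (- P A)) addrK.
by rewrite (addrAC _ (- Z) (P B)) subrK (addrAC _ (- Z) (- P A)) subrK.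
Qed.

(** Evaluation at a fixed [u] turns operator identities into scalar ones, to which the identities
    over a commutative ring apply with [g x y = form u (E x y)]. *)
Definition form (u : 'rV[C]_d) (M : 'M[C]_d) : C := (u *m M *m u^t*) 0 0.

Lemma formD u M N : form u (M + N) = form u M + form u N.
Proof. by rewrite /form mulmxDr mulmxDl mxE. Qed.

Lemma formZ u a M : form u (a *: M) = a * form u M.
Proof. by rewrite /form -scalemxAr -scalemxAl mxE. Qed.

Lemma formB u M N : form u (M - N) = form u M - form u N.
Proof. by rewrite formD -scaleN1r formZ mulN1r. Qed.

Lemma form_sum u (I : finType) (Q : pred I) (F : I -> 'M[C]_d) :
  form u (\sum_(i | Q i) F i) = \sum_(i | Q i) form u (F i).
Proof. by rewrite /form mulmx_sumr mulmx_suml summxE. Qed.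

Lemma form_laplacian u A : A \subset B ->
  form u (#|A|%:R *: (1%:M - P A))
  = #|A|%:R * form u W - form u (rest_part A)
    + k * laplacian (fun x y => form u (E x y)) A.
Proof.
move=> AB; rewrite laplacian_decomp // formD formB (formZ _ _ W) (formZ _ k).
congr (_ + _ * _); rewrite formB formZ !form_sum; congr (_ - _).
by apply: eq_bigr => x _; rewrite form_sum.
Qed.

(** This is s v_q^* with s = |A| v_q - sum of the v_x over [A]. The right factor v_q^* makes it an
    operator and contracts to 1 in a product with an adjoint. *)
Definition star_vec q A : 'M[C]_d := #|A|%:R *: E q q - \sum_(x in A) E x q.

Lemma form_star_vec u q (X Y : {set T}) :
    q \in B -> X \subset B -> Y \subset B ->
  form u (star_vec q X *m (star_vec q Y)^t*)
  = star_form (fun x y => form u (E x y)) q X Y.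
Proof.
move=> qB /subsetP XB /subsetP YB; set rhs := RHS.
have -> : (star_vec q Y)^t* = #|Y|%:R *: E q q - \sum_(y in Y) E q y.
  rewrite adjmxB adjmxZ rmorph_nat adjmx_sum mx_unit_adj //.
  by congr (_ - _); apply: eq_bigr => y /YB yB; rewrite mx_unit_adj.
rewrite mulmxBl !mulmxBr -!scalemxAl -!scalemxAr !formB !formZ mx_unitM //.
rewrite mulmx_sumr mulmx_suml !form_sum.
rewrite (eq_bigr (fun y => form u (E q y))) => [|y /YB yB]; last first.
  by rewrite mx_unitM.
rewrite [X in _ - (_ * X - _)](eq_bigr (fun x => form u (E x q))); last first.
  by move=> x /XB xB; rewrite mx_unitM.
rewrite mulmx_suml form_sum.
rewrite [X in _ - (_ - X)](eq_bigr
  (fun x => \sum_(y in Y) form u (E x y))); last first.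
  move=> x /XB xB; rewrite mulmx_sumr form_sum; apply: eq_bigr => y /YB yB.
  by rewrite mx_unitM.
by rewrite /rhs /star_form mulrA opprB addrA addrAC.
Qed.

End MatrixUnits.

(** * The inequality for a pair of sets, and its weighted sum *)

Definition sym_laplacian A : 'M[C]_d := #|A|%:R *: (1%:M - P A).
Local Notation L := sym_laplacian.

Lemma form_pair_ge (B X Y : {set T}) u q :
    q |: X \subset B -> q |: Y \subset B -> q \notin X -> q \notin Y ->
    (#|X :\: Y| <= 1)%N -> (#|Y :\: X| <= 1)%N ->
    rest_part B (q |: X) = 0 -> rest_part B (q |: Y) = 0 ->
  std_scale B * (form u (star_vec B q X *m (star_vec B q Y)^t*)
                 + form u (star_vec B q Y *m (star_vec B q X)^t*))
  <= #|X|%:R * (form u (L (q |: Y)) - form u (L Y))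
     + #|Y|%:R * (form u (L (q |: X)) - form u (L X))
     - (form u (L (X :|: Y)) + form u (L (X :&: Y))).
Proof.
move=> qXB qYB qX qY XY YX rX rY.
have /andP[qB XB] : (q \in B) && (X \subset B) by rewrite -sub1set -subUset.
have YB : Y \subset B by apply: subset_trans qYB; apply: subsetUr.
have UB : X :|: Y \subset B by rewrite subUset XB.
have IB : X :&: Y \subset B by apply: subset_trans XB; apply: subsetIl.
rewrite !form_star_vec // -laplacian_pair //.
rewrite /L !(@form_laplacian B) // rX rY.
have -> : form u 0 = 0 by rewrite -(scale0r 0) formZ mul0r.
rewrite -subr_ge0 !cardsU1 qX qY /= !natrD.
(* The coefficient of [form u W] is |X| + |Y| minus the sizes of the union and the intersection,
   hence 0. *)
have := congr1 (fun m => m%:R : C) (cardsUI X Y); rewrite /= !natrD.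
move=> /(canRL (addrK _)) ->.
set hX := form u (rest_part B X); set hY := form u (rest_part B Y).
set hU := form u (rest_part B (X :|: Y)).
set hI := form u (rest_part B (X :&: Y)).
have h A : A \subset B -> 0 <= form u (rest_part B A).
  by move=> AB; apply: rest_part_psd.
set r := (X in 0 <= X).
have -> : r = #|X|%:R * hY + #|Y|%:R * hX + (hU + hI) by rewrite /r; ring.
by rewrite !addr_ge0 ?mulr_ge0 ?ler0n ?h.
Qed.

Lemma form_octopus_ge0 (t : nat) q (A : 'I_t.+1 -> {set T})
    (c : 'I_t.+1 -> C) u :
    q \notin A ord0 ->
    (forall i, A i \subset A ord0) ->
    (forall i, #|A ord0 :\: A i| <= 1)%N ->
    (forall i j, i != j -> A i :|: A j = A ord0) ->
    (forall i, 0 <= c i) ->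
  0 <= form u
    ((\sum_i c i * #|A i|%:R) *:
       (\sum_j c j *: (L (q |: A j) - L (A j)))
     - (\sum_i c i ^+ 2 *: L (A i)
        + \sum_(i < t.+1) \sum_(j < t.+1 | (i < j)%N)
            (c i * c j) *: (L (A ord0) + L (A i :&: A j)))).
Proof.
move=> qA0 AS AD AU c0.
pose B := q |: A ord0.
pose a (X : {set T}) := form u (L X).
pose b i := a (q |: A i) - a (A i).
have qA i : q \notin A i by apply: contra qA0; apply/subsetP.
have qAB i : q |: A i \subset B by rewrite setUS.
have D1 i j : (#|A i :\: A j| <= 1)%N.
  by apply: leq_trans (AD j); apply/subset_leq_card/setSD.
(* [q |: A i] is [B], or [B] without the one point missing from [A i]. *)
have r0 i : rest_part B (q |: A i) = 0.
  have := AD i; rewrite leq_eqVlt ltnS leqn0 => /orP[/cards1P[x Dx]|].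
    have -> : q |: A i = B :\ x.
      apply/setP => z; have /setP/(_ z) := Dx; rewrite !inE => <-.
      have /implyP := subsetP (AS i) z.
      have [->|] := eqVneq z q; first by rewrite (negPf qA0) andbF.
      by case: (z \in A i); case: (z \in A ord0).
    rewrite rest_partD1 //.
    by have := set11 x; rewrite -Dx !inE => /andP[_ ->]; rewrite orbT.
  rewrite cards_eq0 setD_eq0 => A0i.
  have -> : A i = A ord0 by apply/eqP; rewrite eqEsubset AS.
  exact: rest_part_full.
pose e i j : C := a (A i :|: A j) + a (A i :&: A j).
set M := form _ _.
(* Symmetrize over ordered pairs. The product of sums is counted twice, each pair i < j occurs
   twice, and [e i i] is [2 a (A i)], so one division by 2 recovers every coefficient. *)
have -> : M = (\sum_i \sum_j c i * c j *
    (#|A i|%:R * b j + #|A j|%:R * b i - e i j)) / 2.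
  apply: (canRL (mulfK _)); first by rewrite pnatr_eq0.
  have -> : \sum_i \sum_j c i * c j *
      (#|A i|%:R * b j + #|A j|%:R * b i - e i j)
    = (\sum_i \sum_j (c i * #|A i|%:R) * (c j * b j)) * 2
      - \sum_i \sum_j c i * c j * e i j.
    rewrite mulr_natr mulr2n [X in _ = _ + X - _]exchange_big /=.
    rewrite -big_split -sumrB; apply: eq_bigr => i _.
    by rewrite -big_split -sumrB; apply: eq_bigr => j _ /=; ring.
  rewrite -big_distrlr (sum2_ltn (fun i j => c i * c j * e i j)).
  have -> : \sum_i c i * c i * e i i = (\sum_i c i ^+ 2 * a (A i)) * 2.
    by rewrite mulr_suml; apply: eq_bigr => i _; rewrite /e setUid setIid; ring.
  have -> : \sum_(i < t.+1) \sum_(j < t.+1 | (i < j)%N)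
      (c i * c j * e i j + c j * c i * e j i)
    = (\sum_(i < t.+1) \sum_(j < t.+1 | (i < j)%N)
         c i * c j * (a (A ord0) + a (A i :&: A j))) * 2.
    rewrite mulr_suml; apply: eq_bigr => i _; rewrite mulr_suml.
    apply: eq_bigr => j ij; rewrite /e setUC (setIC (A j)) AU; first by ring.
    by rewrite eq_sym -val_eqE neq_ltn ij.
  rewrite -mulrDl -mulrBl; congr (_ * _).
  rewrite /M formB formZ formD !form_sum; congr (_ * _ - (_ + _)).
  - by apply: eq_bigr => i _; rewrite formZ formB.
  - by apply: eq_bigr => i _; rewrite formZ.
  apply: eq_bigr => i _; rewrite form_sum; apply: eq_bigr => j _.
  by rewrite formZ formD.
rewrite divr_ge0 ?ler0n //.
pose S := \sum_i c i *: star_vec B q (A i).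
have SS : form u (S *m S^t*)
    = \sum_i \sum_j c i * c j *
        form u (star_vec B q (A i) *m (star_vec B q (A j))^t*).
  rewrite /S adjmx_sum mulmx_suml form_sum; apply: eq_bigr => i _.
  rewrite mulmx_sumr form_sum; apply: eq_bigr => j _.
  by rewrite adjmxZ geC0_conj // -scalemxAl -scalemxAr !formZ mulrA.
(* The factor 2 appears because each pair inequality bounds the cross term together with its
   transpose. *)
apply: (@le_trans _ _ (std_scale B * (form u (S *m S^t*) * 2))).
  have := form_mul_adj_ge0 u S; rewrite -/(form u _) => S0.
  by apply: mulr_ge0; [apply: std_scale_ge0 | apply: mulr_ge0].
rewrite mulr_natr mulr2n SS [X in _ * (_ + X)]exchange_big /= -big_split.
rewrite mulr_sumr; apply: ler_sum => i _.
rewrite -big_split mulr_sumr; apply: ler_sum => j _ /=.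
rewrite (mulrC (c j)) -mulrDr mulrCA ler_wpM2l ?mulr_ge0 //.
exact: form_pair_ge.
Qed.

End Symmetrizers.

Lemma conj_real_complex (R : realType) (x : R) :
  (real_complex R x)^* = real_complex R x.
Proof. exact: conjc_real. Qed.

(** * Involution and representations of the group algebra *)

Section GroupAlgebra.

Variables (R : realType) (gT : finGroupType).
Implicit Types (a b : group_algebra R gT) (k : R[i]).

Lemma ga_starD a b : ga_star (a + b) = ga_star a + ga_star b.
Proof. by apply/ffunP => g; rewrite !ffunE rmorphD. Qed.

Lemma ga_star0 : ga_star (0 : group_algebra R gT) = 0.
Proof. by apply/ffunP => g; rewrite !ffunE rmorph0. Qed.

Lemma ga_starZ k a : ga_star (k *: a) = k^* *: ga_star a.
Proof. by apply/ffunP => g; rewrite !ffunE rmorphM. Qed.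

Lemma ga_starN a : ga_star (- a) = - ga_star a.
Proof. by apply/ffunP => g; rewrite !ffunE rmorphN. Qed.

Lemma ga_star_sum (I : Type) (r : seq I) (Q : pred I)
    (F : I -> group_algebra R gT) :
  ga_star (\sum_(i <- r | Q i) F i) = \sum_(i <- r | Q i) ga_star (F i).
Proof. exact: (big_morph _ ga_starD ga_star0). Qed.

Lemma ga_star_basis (g : gT) : ga_star (ga_basis R g) = ga_basis R g^-1%g.
Proof. by apply/ffunP => h; rewrite !ffunE rmorph_nat eq_invg_sym eq_sym. Qed.

Variables (d : nat) (rho : mx_representation R[i] [set: gT] d).

Lemma ga_opD a b : ga_op rho (a + b) = ga_op rho a + ga_op rho b.
Proof.
by rewrite -big_split; apply: eq_bigr => g _ /=; rewrite ffunE scalerDl.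
Qed.

Lemma ga_op0 : ga_op rho 0 = 0.
Proof. by apply: big1 => g _; rewrite ffunE scale0r. Qed.

Lemma ga_opZ k a : ga_op rho (k *: a) = k *: ga_op rho a.
Proof.
by rewrite scaler_sumr; apply: eq_bigr => g _; rewrite ffunE scalerA.
Qed.

Lemma ga_opB a b : ga_op rho (a - b) = ga_op rho a - ga_op rho b.
Proof. by rewrite -scaleN1r ga_opD ga_opZ scaleN1r. Qed.

Lemma ga_op_sum (I : Type) (r : seq I) (Q : pred I)
    (F : I -> group_algebra R gT) :
  ga_op rho (\sum_(i <- r | Q i) F i) = \sum_(i <- r | Q i) ga_op rho (F i).
Proof. exact: (big_morph _ ga_opD ga_op0). Qed.

Lemma ga_op_basis (g : gT) : ga_op rho (ga_basis R g) = rho g.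
Proof.
rewrite /ga_op (bigD1 g) //= ffunE eqxx scale1r big1 ?addr0 // => h hg.
by rewrite ffunE (negPf hg) scale0r.
Qed.

End GroupAlgebra.

(** * The elements [alpha A] as operators *)

Section AlphaElements.

Variables (R : realType) (n : nat).
Implicit Types (A : {set 'I_n}).

Lemma ga_star_alpha A : ga_star (alpha R A) = alpha R A.
Proof.
rewrite /alpha; case: ifP => _.
  exact: ga_star0.
rewrite ga_starZ fmorphV rmorph_nat ga_star_sum; congr (_ *: _).
rewrite [RHS](reindex_inj invg_inj) /=.
apply: eq_big => [s|s _]; first by rewrite groupV.
by rewrite ga_starD ga_starN !ga_star_basis invg1.
Qed.

Variables (d : nat) (rho : mx_representation R[i] [set: {perm 'I_n}] d).

(** [Sym A] has |A|! elements, and |A|! / (|A| - 1)! is |A|. For empty [A] both sides are 0, by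
    convention on the left and by the factor |A| on the right. *)
Lemma ga_op_alpha A : ga_op rho (alpha R A) = sym_laplacian rho A.
Proof.
rewrite /alpha /sym_laplacian; case: ifP => [/eqP->|/negbT].
  by rewrite cards0 scale0r ga_op0.
rewrite -card_gt0 => A0; rewrite ga_opZ ga_op_sum /sym_proj.
rewrite (eq_bigr (fun s => 1%:M - rho s)) => [|s _]; last first.
  by rewrite ga_opB !ga_op_basis repr_mx1.
rewrite sumrB sumr_const card_Sym -(prednK A0) factS /=.
set m := #|A|.-1; rewrite -[1%:M *+ _]scaler_nat.
have m1 : m.+1%:R != 0 :> R[i] by rewrite pnatr_eq0.
have mf : (m`!)%:R != 0 :> R[i] by rewrite pnatr_eq0 -lt0n fact_gt0.
rewrite !scalerBr !scalerA natrM invfM (mulVKf m1).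
by rewrite mulrCA (mulVf mf) mulr1.
Qed.

Hypothesis rhoU : unitary_repr rho.

Lemma ga_op_self_adjoint (a : group_algebra R {perm 'I_n}) :
  ga_star a = a -> (ga_op rho a)^t* = ga_op rho a.
Proof.
move=> sa; rewrite adjmx_sum [RHS](reindex_inj invg_inj) /=.
apply: eq_bigr => s _; rewrite adjmxZ rho_adj //; congr (_ *: _).
by rewrite -[in RHS]sa ffunE invgK.
Qed.

End AlphaElements.

(** * Transfer of the operator inequality to the group algebra *)

Local Open Scope complex_scope.

Theorem theorem5p3 (R : realType) (n t : nat) (hn : (1 <= n)%N) (ht : (1 <= t)%N)
    (q : 'I_n) (A : 'I_t.+1 -> {set 'I_n})
    (hq : q \notin A ord0)
    (hsub : forall i : 'I_t.+1, (1 <= i)%N -> A i \subset A ord0)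
    (hcard : forall i : 'I_t.+1, (1 <= i)%N -> #|A ord0 :\: A i| = 1%N)
    (hdistinct : forall i j : 'I_t.+1, (1 <= i)%N -> (1 <= j)%N ->
       i != j -> A i != A j)
    (c : 'I_t.+1 -> R) (hc : forall i, 0 <= c i) :
  let C : R := \sum_(i < t.+1) c i * #|A i|%:R in
  ga_succeq
    (C%:C *: \sum_(j < t.+1) (c j)%:C *: (alpha R (q |: A j) - alpha R (A j)))
    (\sum_(i < t.+1) (c i ^+ 2)%:C *: alpha R (A i)
     + \sum_(i < t.+1) \sum_(j < t.+1 | (i < j)%N)
         (c i * c j)%:C *: (alpha R (A ord0) + alpha R (A i :&: A j))).
Proof.
move=> C.
have c0 i : 0 <= (c i)%:C by rewrite ler0c.
have AS i : A i \subset A ord0.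
  by case: (posnP i) => [i0|/hsub//]; rewrite (_ : i = ord0) //; apply: val_inj.
have AD i : (#|A ord0 :\: A i| <= 1)%N.
  case: (posnP i) => [i0|/hcard->//].
  by rewrite (_ : i = ord0) ?setDv ?cards0 //; apply: val_inj.
(* Distinct sets of index at least 1 omit different single points of [A ord0], so their union is all
   of it; this accounts for the term [alpha R (A ord0)] in every pair. *)
have AU i j : i != j -> A i :|: A j = A ord0.
  have [i0 _|i1] := posnP i.
    by rewrite (_ : i = ord0) ?(setUidPl (AS j)) //; apply: val_inj.
  have [j0 _|j1 ij] := posnP j.
    by rewrite (_ : j = ord0) ?(setUidPr (AS i)) //; apply: val_inj.
  have /eqP/cards1P[x Dx] := hcard i i1; have /eqP/cards1P[y Dy] := hcard j j1.
  have Ai : A i = A ord0 :\ x.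
    by rewrite -Dx setDDr setDv set0U (setIidPr (AS i)).
  have Aj : A j = A ord0 :\ y.
    by rewrite -Dy setDDr setDv set0U (setIidPr (AS j)).
  have xy : x != y.
    by apply: contra (hdistinct _ _ i1 j1 ij) => /eqP xy; rewrite Ai Aj xy.
  rewrite Ai Aj -setDIr (_ : [set x] :&: [set y] = set0) ?setD0 //.
  by apply/eqP; rewrite setI_eq0 disjoints1 inE.
set X := C%:C *: _; set Y := _ + _.
have sX : ga_star X = X.
  rewrite ga_starZ conj_real_complex ga_star_sum; congr (_ *: _).
  apply: eq_bigr => j _; rewrite ga_starZ conj_real_complex; congr (_ *: _).
  by rewrite ga_starD ga_starN; congr (_ - _); apply: ga_star_alpha.
have sY : ga_star Y = Y.
  rewrite ga_starD !ga_star_sum; congr (_ + _); apply: eq_bigr => i _.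
    by rewrite ga_starZ conj_real_complex ga_star_alpha.
  rewrite ga_star_sum; apply: eq_bigr => j _.
  rewrite ga_starZ conj_real_complex ga_starD.
  by congr (_ *: (_ + _)); apply: ga_star_alpha.
split=> [//|//|d rho rhoU]; split.
  by apply: ga_op_self_adjoint; rewrite // ga_starD ga_starN sX sY.
move=> u.
(* It remains to identify the image of [X - Y] under [rho] with the operator in this inequality,
   moving the real coefficients through the embedding into [R[i]]. *)
have := form_octopus_ge0 rhoU u hq AS AD AU c0.
rewrite /form; congr (0 <= (u *m _ *m _) 0 0).
rewrite ga_opB ga_opZ ga_opD !ga_op_sum; congr (_ *: _ - (_ + _)).
- by rewrite rmorph_sum; apply: eq_bigr => i _; rewrite rmorphM rmorph_nat.
- apply: eq_bigr => j _; rewrite ga_opZ ga_opB.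
  congr (_ *: (_ - _)); exact/esym/ga_op_alpha.
- by apply: eq_bigr => i _; rewrite ga_opZ ga_op_alpha rmorphXn.
apply: eq_bigr => i _; rewrite ga_op_sum; apply: eq_bigr => j _.
rewrite ga_opZ rmorphM ga_opD.
congr (_ *: (_ + _)); exact/esym/ga_op_alpha.
Qed.
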